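(* For every nonnegative integer $g$, $$\pi_{2,6,6g+5}=\pi_{2,8,8g+7}=\pi_{2,12,12g+11}=\pi_{2,24,24g+23}=0.$$
   Context: For coprime positive integers $a_1,a_2$, let $g_{a_1,a_2}=a_1a_2-a_1-a_2$ and $$\pi_{2,a_1,a_2}=\#\{p \text{ prime}:\ p^2\le g_{a_1,a_2},\ p^2=a_1x_1+a_2x_2 \text{ for some } x_1,x_2\in\mathbb{Z}_{\ge0}\}.$$ *)

(* Defs.v *)
From HB Require Import structures.
From mathcomp Require Import all_boot all_order all_algebra.
From mathcomp Require Import finmap all_classical.

Set Implicit Arguments.
Unset Strict Implicit.
Unset Printing Implicit Defensive.

Import Order.TTheory GRing.Theory Num.Theory.

Local Open Scope classical_set_scope.

(* An integer, not a natural number: it equals -1 when a1 = 1 or a2 = 1. *)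
Definition frobenius (a1 a2 : nat) : int :=
  (a1%:Z * a2%:Z - a1%:Z - a2%:Z)%R.

Definition prime_squares_set (a1 a2 : nat) : set nat :=
  [set p | [/\ prime p, ((p ^ 2)%N%:Z <= frobenius a1 a2)%R &
    exists x1 x2 : nat, (p ^ 2 = a1 * x1 + a2 * x2)%N]].

Lemma finite_prime_squares_set (a1 a2 : nat) :
  finite_set (prime_squares_set a1 a2).
Proof.
apply: (@sub_finite_set _ _ `I_(a1 * a2).+1) (finite_II _) => p /= [_ + _].
rewrite /frobenius => le_p; rewrite ltnS -lez_nat PoszM.
have le_pp2 : (p%:Z <= (p ^ 2)%N%:Z)%R by rewrite lez_nat; case: p {le_p} => // p; rewrite leq_pmulr.
apply: (le_trans le_pp2); apply: (le_trans le_p).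
by rewrite -addrA gerDl -opprD oppr_le0.
Qed.

(* fset_set sends infinite sets to fset0; by finite_prime_squares_set this
   default value is never used here, so this is the true cardinality. *)
Definition pi2 (a1 a2 : nat) : nat :=
  #|` fset_set (prime_squares_set a1 a2)|%fset.

(* Main.v *)
Require Import Defs.
From mathcomp Require Import all_boot.
From mathcomp Require Import all_algebra finmap all_classical zify.

(** Every modulus [a] in the theorem divides 24 and the second generator [b] is
    congruent to -1 modulo [a].  If [p] is coprime to 6 then [p ^ 2] is 1 modulo
    24, so [p ^ 2 = a x + b y] forces [y] to be -1 modulo [a], whence
    [b y >= b (a - 1) > a b - a - b].  For [p <= 3]
    the size of [p ^ 2] leaves only [y <= 1], and [a] divides [p ^ 2 + y], which
    is 4, 5, 9 or 10; its gcd with 24 is less than 6. *)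

Lemma sqr_mod24 (p : nat) : ~~ (2 %| p) -> ~~ (3 %| p) -> p ^ 2 = 1 %[mod 24].
Proof.
move=> p2 p3; rewrite -modnXm.
have {p2} : ~~ (2 %| p %% 24) by rewrite /dvdn modn_dvdm.
have {p3} : ~~ (3 %| p %% 24) by rewrite /dvdn modn_dvdm.
have : p %% 24 < 24 by rewrite ltn_mod.
by move: (p %% 24); do 24! case=> //.
Qed.

Lemma prime_sqr_mod24 (p : nat) : prime p -> 3 < p -> p ^ 2 = 1 %[mod 24].
Proof.
move=> pr_p p_gt3; apply: sqr_mod24; rewrite dvdn_prime2 //; lia.
Qed.

(** The bound says that [p ^ 2] exceeds [frobenius a b], with the subtractions moved across to stay
    in [nat]; no prime can then meet the size condition. *)
Lemma pi2_eq0 (a b : nat) :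
    (forall p x y : nat, prime p -> p ^ 2 = a * x + b * y ->
      a * b < p ^ 2 + a + b) ->
  pi2 a b = 0.
Proof.
move=> H; rewrite /pi2.
suff -> : prime_squares_set a b = set0 by rewrite fset_set0 cardfs0.
apply/seteqP; split=> // p /= [pr_p le_p [x [y Dp]]].
by have := H p x y pr_p Dp; move: le_p; rewrite /frobenius; lia.
Qed.

Lemma pi2_dvd24_eq0 (a g : nat) : 5 < a -> a %| 24 -> pi2 a (a * g + a.-1) = 0.
Proof.
move=> a_gt5 a_dvd; set b := a * g + a.-1.
have a_gt0 : 0 < a by apply: leq_trans a_gt5.
have Db : b.+1 = a * g.+1 by rewrite mulnSr /b -addnS prednK.
apply: pi2_eq0 => p x y pr_p Dp.
(* [p ^ 2 + y = a * x + b.+1 * y], and [a] divides [b.+1]. *)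
have a_dvd_sum : a %| p ^ 2 + y.
  by rewrite Dp -addnA [_ + y]addnC -mulSn Db -mulnA -mulnDr dvdn_mulr.
have [p_gt3 | p_le3] := ltnP 3 p.
  have p2_mod : p ^ 2 = 1 %[mod a].
    by rewrite -(modn_dvdm _ a_dvd) prime_sqr_mod24 // modn_dvdm.
  have a_dvd_yS : a %| y.+1.
    by move: a_dvd_sum; rewrite /dvdn -modnDml p2_mod modnDml add1n.
  (* As a positive multiple of [a], [y.+1] is at least [a]. *)
  have : a * b <= y.+1 * b by rewrite leq_mul2r dvdn_leq ?orbT.
  by rewrite Dp mulSn (mulnC b y); move: (a * b) (a * x) (y * b) a_gt0; clear; lia.
have p_cases : (p == 2) || (p == 3) by move: (prime_gt1 pr_p); lia.
(* Since [b >= a.-1 >= 5], [y >= 2] would give [p ^ 2 >= 10]. *)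
have y_le1 : y <= 1.
  have p2_lt10 : p ^ 2 < 10 by case/orP: p_cases => /eqP ->.
  have b_ge5 : 4 < b by rewrite /b; lia.
  by move: p2_lt10; rewrite Dp; case: y {Dp a_dvd_sum} => [|[|y]] //; rewrite !mulnS; lia.
have : a <= gcdn 24 (p ^ 2 + y).
  by rewrite dvdn_leq ?gcdn_gt0 // dvdn_gcd a_dvd.
rewrite leqNgt (leq_ltn_trans _ a_gt5) //.
by case/orP: p_cases => /eqP ->; case: y y_le1 {Dp a_dvd_sum} => [|[|]].
Qed.

Theorem theorem8 (g : nat) :
  [/\ pi2 6 (6 * g + 5) = 0,
      pi2 8 (8 * g + 7) = 0,
      pi2 12 (12 * g + 11) = 0 &
      pi2 24 (24 * g + 23) = 0].
Proof. by split; apply: pi2_dvd24_eq0. Qed.
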